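(* In the non-stationary non-deterministic bandit described in the context, satisfying the stated assumption with constants $\theta>1$, $\xi>1$, $1/2\le\eta<1$, where $\xi$ is large enough that $\alpha>2$ satisfies $\xi\eta(1-\eta)\le\alpha<\xi(1-\eta)$, run the UCB algorithm of the context and let $$\hat\rho^{\mathrm{stream}}_n=\frac1\beta\ln\Big(\frac1n\sum_{i=1}^K\sum_{s'\in\mathcal{S}}\sum_{t=1}^{T^{s'}_i(T_i(n))}\exp\big(\beta(c_i+\gamma x^{s'}_{i,t})\big)\Big).$$ Then 1. there exist constants $\theta''>1$, $\xi''>1$, $1/2\le\eta''<1$ such that for every $n\in\mathbb{N}$ and $z\ge1$, $$\mathbb{P}[n\hat\rho^{\mathrm{stream}}_n-n\mu^*\ge n^{\eta''}z]\le\frac{\theta''}{z^{\xi''}},\qquad \mathbb{P}[n\hat\rho^{\mathrm{stream}}_n-n\mu^*\le -n^{\eta''}z]\le\frac{\theta''}{z^{\xi''}},$$ where $\eta''=\frac{\alpha}{\xi(1-\eta)}$, $\xi''=\alpha-1$, and $\theta''$ depends on $R,K,\Delta_{\min},\beta,\theta,\xi,\alpha,\eta$ (and on $\theta^L$); 2. $|\mu^*-\mathbb{E}[\hat\rho^{\mathrm{stream}}_n]|=O\big(\theta''n^{\frac{\alpha}{\xi(1-\eta)}-1}\big)$, in particular $\lim_{n\to\infty}\mathbb{E}[\hat\rho^{\mathrm{stream}}_n]=\mu^*$.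
   Context: Non-deterministic bandit with $K$ arms and finite state set $\mathcal{S}$, $\beta>0$, $\gamma\in(0,1]$. Selecting arm $i$ yields a deterministic cost $c_i\in[-R_c,R_c]$ and a next state $s'$ drawn independently each time from a distribution $P^i$ on $\mathcal{S}$; for each $i,s'$ there is a sequence of (possibly non-stationary) random costs $(x^{s'}_{i,t})_{t\ge1}$ in $[-R_x,R_x]$, the $t$-th cost obtained after state $s'$ follows arm $i$. $R=R_c+R_x$. Let $\hat\rho^{s'}_{i,n}=\frac1{\beta\gamma}\ln(\frac1n\sum_{t=1}^n e^{\beta\gamma x^{s'}_{i,t}})$, $\mu^{s'}_{i,n}=\mathbb{E}[\hat\rho^{s'}_{i,n}]$. Assumption: $\lim_n\mu^{s'}_{i,n}=\mu^{s'}_i$ exists and $\mathbb{P}[n\hat\rho^{s'}_{i,n}-n\mu^{s'}_i\ge n^\eta z]\le\theta/z^\xi$, $\mathbb{P}[n\hat\rho^{s'}_{i,n}-n\mu^{s'}_i\le -n^\eta z]\le\theta/z^\xi$ for all $i,s'$, $z\ge1$, $n\in\mathbb{N}$. With $T^{s'}_i(n)$ the number of times $s'$ was sampled in the first $n$ selections of arm $i$, $\hat\rho_{i,n}=\frac1\beta\ln\big(\frac1n\sum_{s'}\sum_{t=1}^{T^{s'}_i(n)}\exp(\beta(c_i+\gamma x^{s'}_{i,t}))\big)$, and $\mu_i=\frac1\beta\ln\mathbb{E}_{s'\sim P^i}[\exp(\beta(c_i+\gamma\mu^{s'}_i))]$. Let $\theta^L>1$ be a constant such that $\mathbb{P}[n\hat\rho_{i,n}-n\mu_i\ge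 n^\eta z]\le\theta^L/z^\xi$ and $\mathbb{P}[n\hat\rho_{i,n}-n\mu_i\le -n^\eta z]\le\theta^L/z^\xi$ for all $i$, $z\ge1$, $n$ (such a constant exists). There is a unique arm $i^*$ attaining $\mu^*=\min_i\mu_i$; $\Delta_i=\mu_i-\mu^*$, $\Delta_{\min}=\min_{i\ne i^*}\Delta_i$. Algorithm (with $\alpha>0$): select each arm once, then at timestep $t$ select $a_t=\arg\min_i\{\hat\rho_{i,T_i(t-1)}-b_{t,T_i(t-1)}\}$ with $b_{t,s}=(\theta^L)^{1/\xi}t^{\alpha/\xi}/s^{1-\eta}$, where $T_i(n)$ is the number of selections of arm $i$ during timesteps $1,\dots,n$. *)

(* Defs.v *)
From HB Require Import structures.
From mathcomp Require Import all_boot all_order all_algebra.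
From mathcomp Require Import all_classical all_reals all_analysis.
Set Implicit Arguments. Unset Strict Implicit. Unset Printing Implicit Defensive.
Import Order.TTheory GRing.Theory Num.Theory.
Local Open Scope ring_scope.
Local Open Scope classical_set_scope.

(* Randomness model (all on one probability space T):
   X i s t w : the t-th cost (t >= 1) observed after next-state s following arm i;
   Y i k w   : the next state drawn at the k-th selection (k >= 1) of arm i;
   a t w     : the arm selected by the algorithm at timestep t >= 1. *)

Definition Tstate (K : nat) (S : finType) (T : Type)
  (Y : 'I_K -> nat -> T -> S) (i : 'I_K) (s : S) (m : nat) (w : T) : nat :=
  (\sum_(1 <= k < m.+1) (Y i k w == s))%N.

Definition rho_state (R : realType) (K : nat) (S : finType) (T : Type)
  (beta gamma : R) (X : 'I_K -> S -> nat -> T -> R) (i : 'I_K) (s : S)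
  (n : nat) (w : T) : R :=
  (beta * gamma)^-1 *
    ln (n%:R^-1 * \sum_(1 <= t < n.+1) expR (beta * gamma * X i s t w)).

Definition rho_arm (R : realType) (K : nat) (S : finType) (T : Type)
  (beta gamma : R) (c : 'I_K -> R) (X : 'I_K -> S -> nat -> T -> R)
  (Y : 'I_K -> nat -> T -> S) (i : 'I_K) (n : nat) (w : T) : R :=
  beta^-1 * ln (n%:R^-1 * \sum_(s : S)
     \sum_(1 <= t < (Tstate Y i s n w).+1) expR (beta * (c i + gamma * X i s t w))).

Definition mu_arm (R : realType) (K : nat) (S : finType)
  (beta gamma : R) (c : 'I_K -> R) (Pi : 'I_K -> S -> R)
  (muS : 'I_K -> S -> R) (i : 'I_K) : R :=
  beta^-1 * ln (\sum_(s : S) Pi i s * expR (beta * (c i + gamma * muS i s))).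

Definition Tarm (K : nat) (T : Type) (a : nat -> T -> 'I_K) (i : 'I_K)
  (n : nat) (w : T) : nat :=
  (\sum_(1 <= t < n.+1) (a t w == i))%N.

Definition bonus (R : realType) (thetaL xi alpha eta : R) (t s : nat) : R :=
  thetaL `^ xi^-1 * t%:R `^ (alpha / xi) / s%:R `^ (1 - eta).

Definition ucb_index (R : realType) (K : nat) (S : finType) (T : Type)
  (beta gamma thetaL xi alpha eta : R) (c : 'I_K -> R)
  (X : 'I_K -> S -> nat -> T -> R) (Y : 'I_K -> nat -> T -> S)
  (a : nat -> T -> 'I_K) (t : nat) (i : 'I_K) (w : T) : R :=
  rho_arm beta gamma c X Y i (Tarm a i t.-1 w) w
  - bonus thetaL xi alpha eta t (Tarm a i t.-1 w).

Definition ucb_run (R : realType) (K : nat) (S : finType) (T : Type)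
  (beta gamma thetaL xi alpha eta : R) (c : 'I_K -> R)
  (X : 'I_K -> S -> nat -> T -> R) (Y : 'I_K -> nat -> T -> S)
  (a : nat -> T -> 'I_K) : Prop :=
  (forall w t, (1 <= t <= K)%N -> nat_of_ord (a t w) = t.-1) /\
  (forall w t, (K < t)%N -> forall j : 'I_K,
     ucb_index beta gamma thetaL xi alpha eta c X Y a t (a t w) w <=
     ucb_index beta gamma thetaL xi alpha eta c X Y a t j w).

Definition rho_stream (R : realType) (K : nat) (S : finType) (T : Type)
  (beta gamma : R) (c : 'I_K -> R) (X : 'I_K -> S -> nat -> T -> R)
  (Y : 'I_K -> nat -> T -> S) (a : nat -> T -> 'I_K) (n : nat) (w : T) : R :=
  beta^-1 * ln (n%:R^-1 * \sum_(i < K) \sum_(s : S)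
     \sum_(1 <= t < (Tstate Y i s (Tarm a i n w) w).+1)
        expR (beta * (c i + gamma * X i s t w))).

Definition next_states_iid (d : measure_display) (T : measurableType d)
  (R : realType) (P : probability T R) (K : nat) (S : finType)
  (Y : 'I_K -> nat -> T -> S) (Pi : 'I_K -> S -> R) : Prop :=
  forall (l : seq ('I_K * nat)) (f : 'I_K * nat -> S),
    uniq l -> all (fun p => (0 < p.2)%N) l ->
    P [set w : T | forall p, p \in l -> Y p.1 p.2 w = f p] =
      (\prod_(p <- l) Pi p.1 (f p))%:E.

(* Main.v *)
(* Let G_i(m) = m exp(beta rho_arm i m) be the exponential cost of the first m
   pulls of arm i.  The stream estimate averages the G_i(T_i(n)), while the
   estimate of the optimal arm at n pulls averages G_*(n); the two sums differ by
   at most one bounded summand per suboptimal pull, and ln is Lipschitz away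
   from 0, so
     |n rho_stream - n rho_*(n)| <= C (n - T_*(n)).
   The first n pulls of the optimal arm are covered by the theta^L estimates.
   For the suboptimal pulls, T_i(n) > u with bonus_{n,u} <= Dmin / 2 forces either
   rho_i(u) <= mu_i - Dmin / 2 or rho_*(s) >= mu^* + bonus_{u+s,s} for some s; the
   latter events have total probability sum_s (u + s)^(-alpha) = O(u^(1 - alpha)).
   Taking u of order n^eta2 z gives the tails, and summing the tails over integer
   levels gives the bound on the mean. *)

Require Import Defs.
From HB Require Import structures.
From mathcomp Require Import all_boot all_order all_algebra.
From mathcomp Require Import all_classical all_reals all_analysis.
From mathcomp Require Import measurable_realfun.
From mathcomp Require Import ring lra zify.
Set Implicit Arguments. Unset Strict Implicit. Unset Printing Implicit Defensive.
Import Order.TTheory GRing.Theory Num.Theory.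
Import numFieldNormedType.Exports.
Local Open Scope ring_scope.
Local Open Scope classical_set_scope.

(** * Elementary estimates for logarithms and power sums *)

(** Apply [ln (1 + v) <= v] at [v = (y - x) / x]. Only the subtracted argument has to stay above
    [m]; used in both directions, this makes [ln] Lipschitz with constant [1 / m]. *)
Lemma ln_sub_le (R : realType) (m x y : R) :
  0 < m -> m <= x -> 0 < y -> ln y - ln x <= `|y - x| / m.
Proof.
move=> m0 mx y0; have x0 : 0 < x by exact: lt_le_trans mx.
rewrite -ln_div ?posrE//.
have -> : y / x = 1 + (y - x) / x by field; rewrite gt_eqF.
apply: (@le_trans _ _ ((y - x) / x)).
  by apply: le_ln1Dx; have := divr_gt0 y0 x0; rewrite mulrBl divff ?gt_eqF//; lra.
apply: (@le_trans _ _ (`|y - x| / x)); first by rewrite ler_pM2r ?invr_gt0// ler_norm.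
by rewrite ler_wpM2l// lef_pV2 ?posrE.
Qed.

Lemma dist_ln_le (R : realType) (m x y : R) :
  0 < m -> m <= x -> m <= y -> `|ln y - ln x| <= `|y - x| / m.
Proof.
move=> m0 mx my; have x0 := lt_le_trans m0 mx; have y0 := lt_le_trans m0 my.
rewrite ler_norml ln_sub_le// andbT lerNl opprB distrC.
exact: ln_sub_le.
Qed.

(* Convexity of [x `^ (1 - p)] gives a telescoping majorant. *)
Lemma powRN_le_telescope (R : realType) (p x : R) : 1 < p -> 0 < x ->
  (x + 1) `^ (- p) <= (x `^ (1 - p) - (x + 1) `^ (1 - p)) / (p - 1).
Proof.
move=> p1 x0; have y0 : 0 < x + 1 by lra.
rewrite ler_pdivlMr ?subr_gt0//.
have -> : x `^ (1 - p) = (x + 1) `^ (1 - p) * (x / (x + 1)) `^ (1 - p).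
  rewrite -powRM ?(ltW y0) ?divr_ge0 ?ltW//; congr (_ `^ _).
  by field; rewrite gt_eqF.
have -> : (x + 1) `^ (- p) = (x + 1) `^ (1 - p) / (x + 1).
  rewrite -[X in _ / X]powRr1 ?(ltW y0)// -powRN -powRD; last first.
    by rewrite (gt_eqF y0) implybT.
  by congr (_ `^ _); lra.
set a := (x + 1) `^ (1 - p); set r := (x / (x + 1)) `^ (1 - p).
rewrite (_ : a * r - a = a * (r - 1)) -?mulrA; last by ring.
rewrite ler_wpM2l ?powR_ge0// lerBrDr /r /powR gt_eqF ?divr_gt0//.
apply: le_trans (expR_ge1Dx _); rewrite addrC lerD2l.
have -> : x / (x + 1) = 1 + (- (x + 1)^-1) by field; rewrite gt_eqF.
have h : -1 < - (x + 1)^-1.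
  by rewrite ltrN2 invf_lt1//; lra.
have := le_ln1Dx h; set l := ln _; set v := _^-1 => hl.
have hp : 0 <= p - 1 by lra.
nra.
Qed.

Lemma sum_powRN_shift_le (R : realType) (p : R) (u n : nat) :
  1 < p -> (0 < u)%N ->
  \sum_(1 <= s < n.+1) (u + s)%:R `^ (- p) <= u%:R `^ (1 - p) / (p - 1).
Proof.
move=> p1 u0.
have p0 : 0 < p - 1 by lra.
(* The induction must carry the telescoped end term; it is discarded only afterwards. *)
suff h : \sum_(1 <= s < n.+1) (u + s)%:R `^ (- p) <=
         (u%:R `^ (1 - p) - (u + n)%:R `^ (1 - p)) / (p - 1).
  apply: le_trans h _; rewrite ler_pM2r ?invr_gt0//.
  by rewrite lerBlDr lerDl powR_ge0.
elim: n => [|n IH]; first by rewrite big_nil addn0 subrr mul0r.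
rewrite big_nat_recr//= addnS -natr1.
have un0 : 0 < (u + n)%:R :> R by rewrite ltr0n addn_gt0 u0.
apply: le_trans (lerD IH (powRN_le_telescope p1 un0)) _.
by rewrite -mulrDl ler_pM2r ?invr_gt0//; lra.
Qed.

Lemma sum_powRN_le (R : realType) (p : R) (n : nat) : 1 < p ->
  \sum_(1 <= s < n.+1) s%:R `^ (- p) <= 1 + 1 / (p - 1).
Proof.
move=> p1; case: n => [|n]; first by rewrite big_nil addr_ge0// divr_ge0//; lra.
rewrite big_nat_recl//= powR1 lerD2l.
by have := @sum_powRN_shift_le R p 1 n p1 isT; rewrite powR1.
Qed.

(** * Exponential cost sums along a fixed outcome *)

Section arm_sum.
Variables (R : realType) (K : nat) (S : finType) (T : Type).
Variables (beta gamma : R) (c : 'I_K -> R) (X : 'I_K -> S -> nat -> T -> R).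
Variable Y : 'I_K -> nat -> T -> S.

Lemma TstateS i s m w :
  Tstate Y i s m.+1 w = (Tstate Y i s m w + (Y i m.+1 w == s))%N.
Proof. by rewrite /Tstate big_nat_recr. Qed.

(** This is $G_i(m)$ of the overview. Unlike [rho_arm] it is additive over pulls, so totals can be
    compared pull by pull. *)
Definition arm_sum (i : 'I_K) (m : nat) (w : T) : R :=
  \sum_(s : S) \sum_(1 <= t < (Tstate Y i s m w).+1)
    expR (beta * (c i + gamma * X i s t w)).

Lemma arm_sum0 i w : arm_sum i 0 w = 0.
Proof. by rewrite /arm_sum big1// => s _; rewrite /Tstate !big_nil. Qed.

(** A pull lengthens only the inner sum of the state it visits, and by a single term. *)
Lemma arm_sumS i m w : arm_sum i m.+1 w = arm_sum i m w +
  expR (beta * (c i + gamma *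
    X i (Y i m.+1 w) (Tstate Y i (Y i m.+1 w) m w).+1 w)).
Proof.
rewrite /arm_sum (bigD1 (Y i m.+1 w))//= [in RHS](bigD1 (Y i m.+1 w))//=.
rewrite TstateS eqxx addn1 big_nat_recr//= -!addrA; congr (_ + _).
rewrite addrC; congr (_ + _); apply: eq_bigr => s.
by rewrite eq_sym => /negPf ns; rewrite TstateS ns addn0.
Qed.

Variables (b : R) (w : T).
Hypothesis cost_b : forall i s t, `|c i + gamma * X i s t w| <= b.
Hypothesis beta_gt0 : 0 < beta.

Lemma arm_sum_increment i m k :
  k%:R * expR (- (beta * b)) <= arm_sum i (m + k) w - arm_sum i m w
  <= k%:R * expR (beta * b).
Proof.
elim: k => [|k IH]; first by rewrite addn0 subrr !mul0r lexx.
rewrite addnS arm_sumS -natr1; set s := Y _ _ _; set t := (Tstate _ _ _ _ _).+1.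
have lo : expR (- (beta * b)) <= expR (beta * (c i + gamma * X i s t w)).
  by rewrite ler_expR -mulrN ler_pM2l//; move: (cost_b i s t); rewrite ler_norml => /andP[].
have hi : expR (beta * (c i + gamma * X i s t w)) <= expR (beta * b).
  by rewrite ler_expR ler_pM2l//; move: (cost_b i s t); rewrite ler_norml => /andP[].
by case/andP: IH => *; rewrite !mulrDl !mul1r; apply/andP; split; lra.
Qed.

Lemma arm_sum_bounds i m :
  m%:R * expR (- (beta * b)) <= arm_sum i m w <= m%:R * expR (beta * b).
Proof. by have := arm_sum_increment i 0 m; rewrite add0n arm_sum0 subr0. Qed.

Variable a : nat -> T -> 'I_K.

Lemma TarmS i n v : Tarm a i n.+1 v = (Tarm a i n v + (a n.+1 v == i))%N.
Proof. by rewrite /Tarm big_nat_recr. Qed.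

Lemma sum_Tarm n v : (\sum_(i < K) Tarm a i n v)%N = n.
Proof.
elim: n => [|n IH]; first by rewrite big1// => i _; rewrite /Tarm big_nil.
under eq_bigr do rewrite TarmS.
rewrite big_split/= IH (bigD1 (a n.+1 v))//= eqxx big1 ?addn0 ?addn1//.
by move=> i; rewrite eq_sym => /negPf ->.
Qed.

Lemma sum_Tarm_ne j n v :
  (\sum_(i < K | i != j) Tarm a i n v)%N = (n - Tarm a j n v)%N.
Proof. by rewrite -[X in (X - _)%N](sum_Tarm n v) [in RHS](bigD1 j)//= addKn. Qed.

Lemma Tarm_le i n v : (Tarm a i n v <= n)%N.
Proof. by rewrite -[leqRHS](sum_Tarm n v) (bigD1 i)//= leq_addr. Qed.

(* Replacing the pulls of the other arms by pulls of arm [j] changes one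
   summand per pull. *)
Lemma dist_sum_arm_sum j n :
  `|\sum_(i < K) arm_sum i (Tarm a i n w) w - arm_sum j n w|
  <= (n - Tarm a j n w)%:R * expR (beta * b).
Proof.
set N := (n - _)%N.
have /andP[d0 d1] : 0 <= arm_sum j n w - arm_sum j (Tarm a j n w) w
    <= N%:R * expR (beta * b).
  have := arm_sum_increment j (Tarm a j n w) N.
  rewrite subnKC ?Tarm_le// => /andP[h ->]; rewrite andbT.
  by apply: le_trans h; rewrite mulr_ge0 ?expR_ge0.
have /andP[e0 e1] : 0 <= \sum_(i < K | i != j) arm_sum i (Tarm a i n w) w
    <= N%:R * expR (beta * b).
  rewrite sumr_ge0 => [|i _]; last first.
    have /andP[h _] := arm_sum_bounds i (Tarm a i n w).
    by apply: le_trans h; rewrite mulr_ge0 ?expR_ge0.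
  rewrite /N -sum_Tarm_ne natr_sum mulr_suml ler_sum// => i _.
  by have /andP[] := arm_sum_bounds i (Tarm a i n w).
by rewrite (bigD1 j)//= ler_norml; apply/andP; split; lra.
Qed.

Lemma arm_sum_mean_ge i n : (0 < n)%N ->
  expR (- (beta * b)) <= n%:R^-1 * arm_sum i n w.
Proof.
move=> n0; rewrite [leRHS]mulrC ler_pdivlMr ?ltr0n// [leLHS]mulrC.
by have /andP[] := arm_sum_bounds i n.
Qed.

(** The pull counts of all arms add up to [n], so the stream total consists of [n] exponentials,
    each at least [expR (- (beta * b))]. *)
Lemma stream_mean_ge n : (0 < n)%N ->
  expR (- (beta * b)) <= n%:R^-1 * \sum_(i < K) arm_sum i (Tarm a i n w) w.
Proof.
move=> n0; rewrite [leRHS]mulrC ler_pdivlMr ?ltr0n// [leLHS]mulrC.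
rewrite -[X in X%:R * _](sum_Tarm n w) natr_sum mulr_suml ler_sum// => i _.
by have /andP[] := arm_sum_bounds i (Tarm a i n w).
Qed.

(** One factor [expR (beta * b)] bounds the change of the sum per pull, the other is the Lipschitz
    constant of [ln] above [expR (- (beta * b))]; the factor [n] cancels against the averaging. *)
Lemma dist_rho_stream_arm j n : (0 < n)%N ->
  `|n%:R * rho_stream beta gamma c X Y a n w - n%:R * rho_arm beta gamma c X Y j n w|
  <= expR (2 * (beta * b)) / beta * (n - Tarm a j n w)%:R.
Proof.
move=> n0; have n0' : 0 < n%:R :> R by rewrite ltr0n.
rewrite -mulrBr -mulrBr !normrM (gtr0_norm n0') (gtr0_norm (_ : 0 < beta^-1)) ?invr_gt0//.
have := dist_ln_le (expR_gt0 _) (arm_sum_mean_ge j n0) (stream_mean_ge n0).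
rewrite -mulrBr normrM gtr0_norm ?invr_gt0// => h.
set e := expR (beta * b) in h *; set N := (_ - _)%:R.
apply: (@le_trans _ _ (n%:R * (beta^-1 * (n%:R^-1 * (N * e) / expR (- (beta * b)))))).
  rewrite ler_pM2l// ler_pM2l ?invr_gt0//; apply: le_trans h _.
  by rewrite ler_pM2r ?invr_gt0 ?expR_gt0// ler_pM2l ?invr_gt0//; exact: dist_sum_arm_sum.
rewrite expRN invrK (_ : 2 * (beta * b) = beta * b + beta * b); last by ring.
rewrite expRD -/e le_eqVlt; apply/orP; left; apply/eqP.
by field; rewrite !gt_eqF.
Qed.

Lemma rho_stream_bounded n : (0 < n)%N -> `|rho_stream beta gamma c X Y a n w| <= b.
Proof.
move=> n0.
have lo := stream_mean_ge n0.
have hi : n%:R^-1 * \sum_(i < K) arm_sum i (Tarm a i n w) w <= expR (beta * b).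
  rewrite [leLHS]mulrC ler_pdivrMr ?ltr0n// [leRHS]mulrC.
  rewrite -[X in _ <= X%:R * _](sum_Tarm n w) natr_sum mulr_suml ler_sum// => i _.
  by have /andP[] := arm_sum_bounds i (Tarm a i n w).
have p0 := lt_le_trans (expR_gt0 _) lo.
have -> : rho_stream beta gamma c X Y a n w =
    beta^-1 * ln (n%:R^-1 * \sum_(i < K) arm_sum i (Tarm a i n w) w) by [].
rewrite normrM gtr0_norm ?invr_gt0// [leLHS]mulrC ler_pdivrMr// [leRHS]mulrC ler_norml.
apply/andP; split; [rewrite -[leLHS]expRK|rewrite -[leRHS]expRK];
  by rewrite ler_ln ?posrE ?expR_gt0.
Qed.

End arm_sum.

(** * Pathwise behaviour of the UCB rule *)

Section ucb_pointwise.
Variables (R : realType) (K : nat) (S : finType) (T : Type).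
Variables (beta gamma thetaL xi alpha eta : R) (c : 'I_K -> R).
Variables (X : 'I_K -> S -> nat -> T -> R) (Y : 'I_K -> nat -> T -> S).
Variable a : nat -> T -> 'I_K.

(** The timestep is that of pull number [u + 1]: arm [i] is chosen there while its estimate rests on
    exactly [u] pulls. *)
Lemma Tarm_last_pull i u n w : (u < Tarm a i n w)%N ->
  exists t, [/\ (1 <= t <= n)%N, a t w = i & Tarm a i t.-1 w = u].
Proof.
elim: n => [|n IH]; first by rewrite /Tarm big_nil.
rewrite TarmS; case: (ltnP u (Tarm a i n w)) => [/IH[t [/andP[t1 tn] at_ ut]] _|le_Tu].
  by exists t; split=> //; rewrite t1 leqW.
case: eqP => [ai|_]; last by lia.
by exists n.+1; split=> //=; lia.
Qed.

Lemma Tarm_mono i w : {homo (fun n => Tarm a i n w) : m n / (m <= n)%N}.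
Proof.
apply: homo_leq => [//|m n p /leq_trans|n]; first exact.
by rewrite TarmS leq_addr.
Qed.

Lemma Tarm_pair_le i j n w : i != j -> (Tarm a i n w + Tarm a j n w <= n)%N.
Proof.
move=> ij; rewrite -[leqRHS](sum_Tarm a n w) (bigD1 i)//= leq_add2l.
by rewrite (bigD1 j) 1?eq_sym//= leq_addr.
Qed.

Lemma bonus_homo s : 0 <= alpha / xi ->
  {homo (fun t => bonus thetaL xi alpha eta t s) : t t' / (t <= t')%N >-> t <= t'}.
Proof.
move=> ax0 t t' tt'; rewrite /bonus ler_wpM2r ?invr_ge0 ?powR_ge0//.
by rewrite ler_wpM2l ?powR_ge0// ge0_ler_powR ?nnegrE// ler_nat.
Qed.

Hypothesis run : ucb_run beta gamma thetaL xi alpha eta c X Y a.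

(** Arms are numbered from 0 and timesteps from 1, so arm [i] has its initial pull at timestep
    [i + 1]. *)
Lemma Tarm_round_robin i t w : (t <= K)%N -> Tarm a i t w = (i < t)%N.
Proof.
elim: t => [|t IH] tK; first by rewrite /Tarm big_nil.
have := run.1 w t.+1; rewrite tK => /(_ isT) at1.
rewrite TarmS (IH (ltnW tK)).
have -> : (a t.+1 w == i) = (t == i :> nat).
  by apply/eqP/eqP => [<-//|ti]; apply: val_inj; rewrite /= at1.
by case: (ltngtP (i : nat) t); lia.
Qed.

(* While arm [i] stands at [u] pulls and arm [j] at [s], time has advanced at
   least to [u + s], so a failed upper bound on arm [j] already fails with the
   bonus of time [u + s], and no union over time is needed. *)
Lemma ucb_excess_pulls i j u n (D mi mj : R) w :
  0 <= alpha / xi -> (0 < u)%N -> i != j -> D <= mi - mj ->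
  bonus thetaL xi alpha eta n u <= D / 2 -> (u < Tarm a i n w)%N ->
  rho_arm beta gamma c X Y i u w <= mi - D / 2 \/
  exists2 s, (1 <= s <= n)%N &
    mj + bonus thetaL xi alpha eta (u + s) s <= rho_arm beta gamma c X Y j s w.
Proof.
move=> ax0 u0 ij Dle bD /Tarm_last_pull[t [/andP[t1 tn] ati ut]].
(* In the first [K] timesteps an arm is chosen only when it has no earlier pull, against [0 < u]. *)
have Kt : (K < t)%N.
  rewrite ltnNge; apply/negP => tK; move: (ut).
  rewrite Tarm_round_robin ?(leq_trans (leq_pred _))//.
  have := run.1 w t; rewrite t1 tK ati => /(_ isT) ->.
  by rewrite ltnn; lia.
case: (leP (rho_arm beta gamma c X Y i u w) (mi - D / 2)) => h; first by left.
right; set s := Tarm a j t.-1 w.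
have us : (u + s <= t.-1)%N by rewrite -ut; exact: Tarm_pair_le.
have s1 : (1 <= s)%N.
  apply: leq_trans (Tarm_mono j w (_ : (K <= t.-1)%N)); last by lia.
  by rewrite Tarm_round_robin// ltn_ord.
exists s; first by lia.
(* Otherwise the index of [i] exceeds [mi - D / 2 - D / 2 >= mj], while that of [j] is below [mj],
   so [i] would not have been chosen at [t]. *)
rewrite leNgt; apply/negP => hs.
have := run.2 w t Kt j; rewrite ati /ucb_index ut -/s.
have b1 : bonus thetaL xi alpha eta t u <= bonus thetaL xi alpha eta n u by exact: bonus_homo.
have b2 : bonus thetaL xi alpha eta (u + s) s <= bonus thetaL xi alpha eta t s.
  by apply: bonus_homo => //; lia.
lra.
Qed.

End ucb_pointwise.

(** * Measurability of counts, estimates and events *)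

Section measurability.
Variables (d : measure_display) (T : measurableType d) (R : realType).

(** Splitting the preimage over the countably many values of [N] handles sums whose upper limit is
    random. *)
Lemma measurable_fun_nat_index d' (U : measurableType d') (N : T -> nat)
    (F : nat -> T -> U) :
  measurable_fun setT N -> (forall k, measurable_fun setT (F k)) ->
  measurable_fun setT (fun w => F (N w) w).
Proof.
move=> mN mF _ B mB; rewrite setTI.
rewrite (_ : _ @^-1` B = \bigcup_k ((N @^-1` [set k]) `&` (F k @^-1` B))).
  apply: bigcupT_measurable => k; apply: measurableI.
    by rewrite -[X in measurable X]setTI; exact: mN.
  by rewrite -[X in measurable X]setTI; exact: mF.
apply/seteqP; split => w /=; first by exists (N w).
by move=> [k _ [/= ->]].
Qed.

Lemma measurable_set_ge (f : T -> R) (r : R) : measurable_fun setT f ->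
  measurable [set w | (f w >= r)%R].
Proof.
move=> mf; rewrite (_ : [set _ | _] = setT `&` f @^-1` `[r, +oo[).
  by apply: mf => //; exact: measurable_itv.
by apply/seteqP; split => w /=; rewrite in_itv/= andbT; [split|case].
Qed.

Lemma measurable_set_le (f : T -> R) (r : R) : measurable_fun setT f ->
  measurable [set w | (f w <= r)%R].
Proof.
move=> mf; rewrite (_ : [set _ | _] = setT `&` f @^-1` `]-oo, r]).
  by apply: mf => //; exact: measurable_itv.
by apply/seteqP; split => w /=; rewrite in_itv/=; [split|case].
Qed.

Lemma measurable_fun_count (A : nat -> pred T) n :
  (forall k, measurable [set w | A k w]) ->
  measurable_fun setT (fun w => \sum_(1 <= k < n.+1) A k w)%N.
Proof.
move=> mA; elim: n => [|n IH].
  under eq_fun do rewrite big_nil.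
  exact: measurable_cst.
under eq_fun do rewrite big_nat_recr//=.
apply: (measurable_fun_nat_index (F := fun k w => (k + A n.+1 w)%N)) => // k.
apply: (measurableT_comp (f := fun b : bool => (k + b)%N)) => //.
apply: (@measurable_fun_bool _ _ _ _ true).
by rewrite setTI; exact: mA.
Qed.

Variables (K : nat) (S : finType) (beta gamma : R) (c : 'I_K -> R).
Variables (X : 'I_K -> S -> nat -> T -> R) (Y : 'I_K -> nat -> T -> S).
Variable a : nat -> T -> 'I_K.
Hypothesis mX : forall i s t, measurable_fun setT (X i s t).
Hypothesis mY : forall i k s, measurable [set w | Y i k w = s].
Hypothesis ma : forall t i, measurable [set w | a t w = i].

Lemma measurable_Tstate i s m : measurable_fun setT (Tstate Y i s m).
Proof.
apply: (measurable_fun_count (A := fun k w => Y i k w == s)) => k.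
rewrite (_ : [set _ | _] = [set w | Y i k w = s])//.
by apply/seteqP; split => w /= /eqP.
Qed.

Lemma measurable_Tarm i n : measurable_fun setT (Tarm a i n).
Proof.
apply: (measurable_fun_count (A := fun k w => a k w == i)) => k.
rewrite (_ : [set _ | _] = [set w | a k w = i])//.
by apply/seteqP; split => w /= /eqP.
Qed.

Lemma measurable_arm_sum i m : measurable_fun setT (arm_sum beta gamma c X Y i m).
Proof.
apply: measurable_sum => s.
apply: (measurable_fun_nat_index (F := fun k w => \sum_(1 <= t < k.+1)
  expR (beta * (c i + gamma * X i s t w)))); first exact: measurable_Tstate.
move=> k; apply: measurable_sum => t.
apply: measurableT_comp; first exact: measurable_expR.
apply: measurable_funM => //; apply: measurable_funD => //.
exact: measurable_funM.
Qed.

Lemma measurable_rho_arm i n : measurable_fun setT (rho_arm beta gamma c X Y i n).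
Proof.
apply: measurable_funM => //.
apply: measurableT_comp; first exact: measurable_ln.
by apply: measurable_funM => //; exact: measurable_arm_sum.
Qed.

Lemma measurable_rho_stream n : measurable_fun setT (rho_stream beta gamma c X Y a n).
Proof.
apply: measurable_funM => //.
apply: measurableT_comp; first exact: measurable_ln.
apply: measurable_funM => //; apply: measurable_sum => i.
apply: (measurable_fun_nat_index (F := arm_sum beta gamma c X Y i)).
  exact: measurable_Tarm.
by move=> k; exact: measurable_arm_sum.
Qed.

End measurability.

(** * Union bound and means from tails *)

(** The covering form lets later arguments name, for each bad outcome, one index responsible for it.
    The induction peels [B j] off [A]. *)
Lemma prob_union_le (d : measure_display) (T : measurableType d) (R : realType)
    (P : probability T R) (I : eqType) (r : seq I) (A : set T)
    (B : I -> set T) (e : I -> R) :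
  measurable A -> (forall j, measurable (B j)) ->
  (forall w, A w -> exists2 j, j \in r & B j w) ->
  (forall j, j \in r -> (P (B j) <= (e j)%:E)%E) ->
  (P A <= (\sum_(j <- r) e j)%:E)%E.
Proof.
move=> + mB; elim: r A => [|j r IH] A mA cov Pe.
  rewrite big_nil (_ : A = set0) ?measure0//.
  by apply/seteqP; split => // w /cov[].
rewrite big_cons EFinD.
apply: (@le_trans _ _ (P (B j `|` (A `\` B j)))%E).
  apply: le_measure; rewrite ?inE//; first by apply: measurableU => //; exact: measurableD.
  by move=> w Aw; have [|] := pselect (B j w); [left|right].
apply: (@le_trans _ _ (P (B j) + P (A `\` B j))%E).
  by apply: measureU2 => //; exact: measurableD.
apply: leeD; first by apply: Pe; rewrite mem_head.
apply: IH; first exact: measurableD.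
- move=> w [/cov[k]]; rewrite inE => /orP[/eqP ->//|kr Bk _]; by exists k.
- by move=> k kr; apply: Pe; rewrite inE kr orbT.
Qed.

Section mean_of_tails.
Variables (d : measure_display) (T : measurableType d) (R : realType).
Variable P : probability T R.

(** A discrete layer-cake formula: the sum counts the integer levels that [g w] reaches, and the 1
    pays for the fractional part. *)
Lemma le_sum_indic_levels (g : T -> R) (M : nat) w : g w < M.+1%:R ->
  g w <= 1 + \sum_(1 <= k < M.+1) \1_[set v | (g v >= k%:R)%R] w.
Proof.
elim: M => [|M IH] gM; first by rewrite big_nil addr0 ltW.
case: (ltP (g w) M.+1%:R) => [/IH h|Mg].
  by rewrite big_nat_recr//= addrA (le_trans h)// lerDl indicE ler0n.
rewrite (@eq_big_nat _ _ _ _ _ _ (fun=> 1)) => [|k /andP[_ kM]].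
  by rewrite sumr_const_nat subn1/= addrC natr1 ltW.
rewrite indicE mem_set//=; apply: le_trans Mg.
by rewrite ler_nat -ltnS.
Qed.

Lemma integral_le_sum_tails (g : T -> R) (b : R) (e : nat -> R) :
  measurable_fun setT g -> (forall w, 0 <= g w <= b) ->
  (forall k, (0 < k)%N -> (P [set w | (g w >= k%:R)%R] <= (e k)%:E)%E) ->
  exists M : nat,
    (\int[P]_w (g w)%:E <= (1 + \sum_(1 <= k < M.+1) e k)%:E)%E.
Proof.
move=> mg gb Pe; exists (Num.trunc b).
have mA k : measurable [set v | (g v >= k%:R)%R] by exact: measurable_set_ge.
apply: (@le_trans _ _ (\int[P]_w ((cst 1%:E w) + \sum_(1 <= k < (Num.trunc b).+1)
    (\1_[set v | (g v >= k%:R)%R] w)%:E))%E).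
  apply: ge0_le_integral => //.
  - by move=> w _; rewrite lee_fin; case/andP: (gb w).
  - exact/measurable_EFinP.
  - apply: emeasurable_funD => //; apply: emeasurable_sum => k.
    by apply/measurable_EFinP; exact: measurable_indic.
  - move=> w _; rewrite sumEFin -EFinD lee_fin.
    apply: le_sum_indic_levels; case/andP: (gb w) => _ /le_lt_trans; apply.
    exact: truncnS_gt.
rewrite ge0_integralD//; last 2 first.
- by move=> w _; rewrite sumEFin lee_fin sumr_ge0// => k _; rewrite indicE.
- by apply: emeasurable_sum => k; apply/measurable_EFinP; exact: measurable_indic.
rewrite integral_cst//= probability_setT mule1 EFinD leeD2l//.
rewrite ge0_integral_sum//; last first.
  by move=> k; apply/measurable_EFinP; exact: measurable_indic.
rewrite -sumEFin big_nat_cond [leRHS]big_nat_cond; apply: lee_sum => k.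
rewrite andbT => /andP[k1 _].
by rewrite integral_indic// setIT; exact: Pe.
Qed.

Lemma dist_mean_le_tails (f : T -> R) (m b u q th : R) :
  measurable_fun setT f -> (forall w, `|f w| <= b) -> 0 < u -> 1 < q -> 0 <= th ->
  (forall z, 1 <= z ->
    (P [set w | (f w - m >= u * z)%R] <= (th / z `^ q)%:E)%E /\
    (P [set w | (f w - m <= - (u * z))%R] <= (th / z `^ q)%:E)%E) ->
  (`| m%:E - 'E_P[f] | <= (u * (1 + 2 * th * (1 + 1 / (q - 1))))%:E)%E.
Proof.
move=> mf fb u0 q1 th0 tails.
pose g w := `|f w - m| / u.
have mfm : measurable_fun setT (fun w => f w - m) by exact: measurable_funB.
have mg : measurable_fun setT g.
  by apply: measurable_funM => //; apply: measurableT_comp => //; exact: normr_measurable.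
have gb w : 0 <= g w <= (b + `|m|) / u.
  rewrite divr_ge0 ?(ltW u0)//= ler_pM2r ?invr_gt0//.
  by apply: le_trans (ler_normB _ _) _; rewrite lerD2r.
have ge k : (0 < k)%N ->
    (P [set w | (g w >= k%:R)%R] <= (2 * th * k%:R `^ (- q))%:E)%E.
  move=> k0; have k1 : 1 <= k%:R :> R by rewrite ler1n.
  have [t1 t2] := tails _ k1.
  have := @prob_union_le _ _ _ P _ [:: true; false] [set w | (g w >= k%:R)%R]
    (fun j => if j then [set w | (f w - m >= u * k%:R)%R]
              else [set w | (f w - m <= - (u * k%:R))%R]) (fun=> th / k%:R `^ q).
  rewrite !big_cons big_nil addr0 -mulrDl -mulr2n -(mulr_natl th) powRN; apply.
  - exact: measurable_set_ge.
  - by case; [exact: measurable_set_ge|exact: measurable_set_le].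
  - move=> w /=; rewrite /g ler_pdivlMr// mulrC ler_normr => /orP[h|h].
      by exists true.
    by exists false; rewrite //= lerNr.
  - by case.
have if_ : P.-integrable setT (EFin \o f).
  apply: measurable_bounded_integrable => //; first by rewrite /= probability_setT ltry.
  by exists b; split; [exact: num_real|move=> M bM w _ /=; exact: le_trans (fb w) (ltW bM)].
have im : P.-integrable setT (EFin \o (fun=> m)).
  apply: measurable_bounded_integrable => //; first by rewrite /= probability_setT ltry.
  by exists `|m|; split; [exact: num_real|move=> M bM w _ /=; exact: ltW].
have -> : (m%:E - 'E_P[f] = \int[P]_w (m%:E - (f w)%:E))%E.
  rewrite (integralB_EFin (f1 := fun=> m))// unlock.
  by have := @expectation_cst _ _ _ P m; rewrite unlock => ->.
have mmf : measurable_fun setT (fun w => m%:E - (f w)%:E)%E.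
  by apply: emeasurable_funB => //; exact/measurable_EFinP.
apply: le_trans (le_abse_integral P measurableT mmf) _.
have -> : (\int[P]_w `|m%:E - (f w)%:E| = \int[P]_w (u%:E * (g w)%:E))%E.
  apply: eq_integral => w _; rewrite -EFinB -EFinM /= /g distrC; congr (_%:E).
  by field; rewrite gt_eqF.
rewrite ge0_integralZl_EFin//; first last.
- exact: ltW.
- exact/measurable_EFinP.
- by move=> w _; rewrite lee_fin; case/andP: (gb w).
have [M hM] := integral_le_sum_tails mg gb ge.
rewrite EFinM; apply: lee_wpmul2l; first by rewrite lee_fin ltW.
apply: le_trans hM _; rewrite lee_fin lerD2l -mulr_sumr.
by rewrite ler_wpM2l ?mulr_ge0// sum_powRN_le.
Qed.

End mean_of_tails.

Lemma cvg_powRN (R : realType) (r : R) : 0 < r ->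
  (fun n : nat => n%:R `^ (- r)) @ \oo --> (0 : R).
Proof.
move=> r0; apply/cvgrPdist_lt => e e0.
near=> n; rewrite sub0r normrN ger0_norm ?powR_ge0//.
have n0 : 0 < n%:R :> R.
  by apply: (@le_lt_trans _ _ (e^-1 `^ r^-1)); [exact: powR_ge0|near: n; exact: nbhs_infty_gtr].
rewrite powRN invf_plt ?posrE ?powR_gt0//.
have -> : e^-1 = (e^-1 `^ r^-1) `^ r.
  by rewrite -powRrM mulVf ?gt_eqF// powRr1// invr_ge0 ltW.
apply: gt0_ltr_powR; rewrite ?nnegrE ?powR_ge0 ?ltW//.
by near: n; exact: nbhs_infty_gtr.
Unshelve. all: by end_near.
Qed.

(** * Tails of the pull counts of suboptimal arms *)

Section ucb_tails.
Variables (R : realType) (K : nat) (S : finType).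
Variables (d : measure_display) (T : measurableType d) (P : probability T R).
Variables (beta gamma thetaL xi alpha eta Dmin b : R) (c : 'I_K -> R).
Variables (X : 'I_K -> S -> nat -> T -> R) (Y : 'I_K -> nat -> T -> S).
Variables (a : nat -> T -> 'I_K) (mu : 'I_K -> R).
Hypothesis thetaL_gt1 : 1 < thetaL.
Hypothesis xi_gt1 : 1 < xi.
Hypothesis eta_lt1 : eta < 1.
Hypothesis alpha_gt2 : 2 < alpha.
Hypothesis alpha_lt : alpha < xi * (1 - eta).
Hypothesis Dmin_gt0 : 0 < Dmin.
Hypothesis mX : forall i s t, measurable_fun setT (X i s t).
Hypothesis mY : forall i k s, measurable [set w | Y i k w = s].
Hypothesis ma : forall t i, measurable [set w | a t w = i].
Hypothesis arm_tails : forall i n z, (1 <= n)%N -> 1 <= z ->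
  (P [set w | (n%:R * rho_arm beta gamma c X Y i n w - n%:R * mu i
                 >= n%:R `^ eta * z)%R] <= (thetaL / z `^ xi)%:E)%E /\
  (P [set w | (n%:R * rho_arm beta gamma c X Y i n w - n%:R * mu i
                 <= - (n%:R `^ eta * z))%R] <= (thetaL / z `^ xi)%:E)%E.
Hypothesis run : ucb_run beta gamma thetaL xi alpha eta c X Y a.

(** The first term pays for underestimating the suboptimal arm, the 1 for all overestimates of the
    better arm together. *)
Definition pull_tail_const : R := thetaL * (2 / Dmin) `^ xi + 1.

Lemma powR_etaV (n : nat) : (0 < n)%N -> n%:R `^ eta * n%:R `^ (1 - eta) = n%:R :> R.
Proof.
move=> n0; rewrite -powRD ?pnatr_eq0 ?gtn_eqF ?implybT//.
by rewrite addrC subrK powRr1.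
Qed.

Let alpha_xi_ge0 : 0 <= alpha / xi.
Proof. by move: alpha_gt2 xi_gt1 => *; apply: divr_ge0; lra. Qed.

(** Take [z = u]^ (1 - eta) * (Dmin / 2)[in the arm tails, so that]u [^ eta * z = u * (Dmin / 2)].
    The resulting decay exponent [xi * (1 - eta)] exceeds [alpha], hence [alpha - 1]. *)
Lemma underestimate_tail i u : (0 < u)%N -> 1 <= u%:R `^ (1 - eta) * (Dmin / 2) ->
  (P [set w | (rho_arm beta gamma c X Y i u w <= mu i - Dmin / 2)%R]
    <= (thetaL * (2 / Dmin) `^ xi * u%:R `^ (1 - alpha))%:E)%E.
Proof.
move: thetaL_gt1 xi_gt1 eta_lt1 alpha_gt2 alpha_lt Dmin_gt0 => tL1 xi1 eta1 al2 alx D0.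
move=> u0 z1; have u0' : 0 < u%:R :> R by rewrite ltr0n.
have [_] := arm_tails i u0 z1.
rewrite mulrA powR_etaV//.
rewrite (_ : [set w | (_ * _ - _ <= _)%R] =
    [set w | (rho_arm beta gamma c X Y i u w <= mu i - Dmin / 2)%R]); last first.
  apply/funext => w; apply/propext => /=.
  rewrite -[X in (_ <= X)%R]mulrN -mulrBr ler_pM2l//.
  by rewrite lerBlDr addrC.
move=> h; apply: le_trans h _; rewrite lee_fin -[leRHS]mulrA ler_pM2l; last by lra.
rewrite powRM ?powR_ge0//; last by lra.
rewrite -powRrM -[2 / Dmin]invf_div invfM [leLHS]mulrC ler_pM ?invr_ge0 ?powR_ge0//.
  rewrite -(@powR_inv1 _ (Dmin / 2)) -?powRrM ?mulN1r ?powRN//; lra.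
by rewrite -powRN ler_powR ?ler1n//; lra.
Qed.

(** The bonus is calibrated for this: with [z] its numerator, [thetaL / z]^ xi[equals](u + s)
    [^ (- alpha)]. *)
Lemma overestimate_tail j u s : (0 < u)%N -> (0 < s)%N ->
  (P [set w | (mu j + bonus thetaL xi alpha eta (u + s) s
                 <= rho_arm beta gamma c X Y j s w)%R]
    <= ((u + s)%:R `^ (- alpha))%:E)%E.
Proof.
move: thetaL_gt1 xi_gt1 eta_lt1 alpha_gt2 alpha_lt Dmin_gt0 => tL1 xi1 eta1 al2 alx D0.
move=> u0 s0; have s0' : 0 < s%:R :> R by rewrite ltr0n.
have us0 : 0 < (u + s)%:R :> R by rewrite ltr0n addn_gt0 u0.
pose z := thetaL `^ xi^-1 * (u + s)%:R `^ (alpha / xi).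
have xiV0 : 0 <= xi^-1 by rewrite invr_ge0; lra.
have z1 : 1 <= z.
  rewrite -[leLHS]mulr1 ler_pM//.
    by rewrite -[leLHS](powRr0 thetaL) ler_powR// ltW.
  by rewrite -[leLHS](powRr0 (u + s)%:R) ler_powR// ler1n addn_gt0 u0.
have [+ _] := arm_tails j s0 z1.
rewrite (_ : [set w | (_ <= _ * _ - _)%R] =
    [set w | (mu j + bonus thetaL xi alpha eta (u + s) s
                 <= rho_arm beta gamma c X Y j s w)%R]); last first.
  have -> : s%:R `^ eta * z = s%:R * bonus thetaL xi alpha eta (u + s) s.
    rewrite /bonus -/z -{2}(powR_etaV s0); field.
    by rewrite gt_eqF ?powR_gt0.
  apply/funext => w; apply/propext => /=.
  by rewrite -mulrBr ler_pM2l// lerBrDl.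
move=> h; apply: le_trans h _; rewrite lee_fin powRM ?powR_ge0// -!powRrM.
rewrite mulVf ?divfK ?powRr1 ?gt_eqF//; try lra.
rewrite powRN invfM mulrA divff ?mul1r// gt_eqF//; lra.
Qed.

Lemma measurable_Tarm_gt i n (r : R) : measurable [set w | (r < (Tarm a i n w)%:R)%R].
Proof.
rewrite (_ : [set _ | _] = setT `&` Tarm a i n @^-1` [set m | (r < m%:R)%R]).
  by apply: measurable_Tarm.
by apply/seteqP; split => w /=; [split|case].
Qed.

Lemma pulls_tail_nat i j u n : (0 < u)%N -> i != j -> Dmin <= mu i - mu j ->
  (0 < n)%N -> bonus thetaL xi alpha eta n u <= Dmin / 2 ->
  (P [set w | (u%:R < (Tarm a i n w)%:R :> R)%R]
    <= (pull_tail_const * u%:R `^ (1 - alpha))%:E)%E.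
Proof.
move: thetaL_gt1 xi_gt1 eta_lt1 alpha_gt2 alpha_lt Dmin_gt0 => tL1 xi1 eta1 al2 alx D0.
move=> u0 ij Dij n0 bD; have u0' : 0 < u%:R :> R by rewrite ltr0n.
(* Index 0 stands for the underestimate of arm [i]; an index [s >= 1] stands for the overestimate of
   arm [j] at [s] pulls. *)
pose B s := if s == 0%N
  then [set w | (rho_arm beta gamma c X Y i u w <= mu i - Dmin / 2)%R]
  else [set w | (mu j + bonus thetaL xi alpha eta (u + s) s
                 <= rho_arm beta gamma c X Y j s w)%R].
pose e s := if s == 0%N then thetaL * (2 / Dmin) `^ xi * u%:R `^ (1 - alpha)
  else (u + s)%:R `^ (- alpha).
apply: (@le_trans _ _ (\sum_(0 <= s < n.+1) e s)%:E).
  apply: (@prob_union_le _ _ _ _ _ _ _ B).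
  - exact: measurable_Tarm_gt.
  - move=> s; rewrite /B; case: ifP => _.
      by apply: measurable_set_le; exact: measurable_rho_arm.
    by apply: measurable_set_ge; exact: measurable_rho_arm.
  - move=> w /=; rewrite ltr_nat => uT.
    have [h|[s /andP[s1 sn] h]] := ucb_excess_pulls run alpha_xi_ge0 u0 ij Dij bD uT.
      by exists 0%N; rewrite ?mem_index_iota.
    by exists s; rewrite ?mem_index_iota//= /B gtn_eqF.
  - move=> s _; rewrite /B /e; case: eqP => [_|/eqP].
      (* The numerator of the bonus is at least 1, so a bonus of at most [Dmin / 2] gives the
         required [1 <= z]. *)
      apply: underestimate_tail => //; move: bD; rewrite /bonus.
      rewrite ler_pdivrMr ?powR_gt0// => bD; rewrite [leRHS]mulrC.
      apply: le_trans bD; rewrite -[leLHS]mulr1 ler_pM//.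
        by rewrite -[leLHS](powRr0 thetaL) ler_powR// ?invr_ge0; lra.
      by rewrite -[leLHS](powRr0 n%:R) ler_powR// ler1n.
    by rewrite -lt0n => s0; exact: overestimate_tail.
rewrite lee_fin big_ltn// {1}/e eqxx /pull_tail_const [leRHS]mulrDl mul1r.
apply: lerD => //.
rewrite (@eq_big_nat _ _ _ _ _ _ (fun s => (u + s)%:R `^ (- alpha))); last first.
  by move=> s /andP[s1 _]; rewrite /e gtn_eqF.
apply: (le_trans (sum_powRN_shift_le _ _ _)) => //; first by lra.
by rewrite ler_pdivrMr ?ler_peMr ?powR_ge0//; lra.
Qed.

Definition pull_scale : R :=
  Num.max 1 ((2 * thetaL `^ xi^-1 / Dmin) `^ (1 - eta)^-1).

Let eta2 := alpha / (xi * (1 - eta)).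

Lemma pull_tail_const_ge0 : 0 <= pull_tail_const.
Proof. by move: thetaL_gt1 => ?; rewrite addr_ge0// mulr_ge0 ?powR_ge0//; lra. Qed.

Lemma pulls_tail i j n z : i != j -> Dmin <= mu i - mu j -> (0 < n)%N -> 1 <= z ->
  (P [set w | (2 * pull_scale * n%:R `^ eta2 * z < (Tarm a i n w)%:R :> R)%R]
    <= (pull_tail_const * z `^ (1 - alpha))%:E)%E.
Proof.
move: thetaL_gt1 xi_gt1 eta_lt1 alpha_gt2 alpha_lt Dmin_gt0 => tL1 xi1 eta1 al2 alx D0.
move=> ij Dij n0 z1; pose v := pull_scale * n%:R `^ eta2 * z.
have n1 : 1 <= n%:R `^ eta2.
  rewrite -[leLHS](powRr0 n%:R) ler_powR ?ler1n//.
  by rewrite divr_ge0// ?mulr_ge0//; lra.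
have scale1 : 1 <= pull_scale by rewrite le_max lexx.
have An1 : 1 <= pull_scale * n%:R `^ eta2 by nra.
have zv : z <= v by rewrite /v; nra.
(* The threshold [v] is rounded up to a pull count; [v >= 1] gives [u <= 2 * v], the source of the
   factor 2. *)
pose u := (Num.trunc v).+1.
have vu : v < u%:R := truncnS_gt v.
have u2v : u%:R <= 2 * v.
  have := @truncn_itv _ v (ltac:(lra)) => /andP[h _].
  by rewrite /u -natr1; lra.
have bD : bonus thetaL xi alpha eta n u <= Dmin / 2.
  have u0 : 0 < u%:R `^ (1 - eta) by rewrite powR_gt0//; lra.
  rewrite /bonus ler_pdivrMr// -ler_pdivrMl; last by lra.
  apply: (@le_trans _ _ (v `^ (1 - eta))); last first.
    by apply: ge0_ler_powR; rewrite ?nnegrE; lra.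
  set t := thetaL `^ xi^-1; set q := (X in _ <= X).
  have -> : (Dmin / 2)^-1 * (t * n%:R `^ (alpha / xi)) =
      ((2 * t / Dmin) `^ (1 - eta)^-1 * n%:R `^ eta2) `^ (1 - eta).
    rewrite powRM ?powR_ge0// -!powRrM mulVf ?gt_eqF ?subr_gt0// powRr1; last first.
      by rewrite divr_ge0 ?mulr_ge0 ?powR_ge0 ?ltW.
    have -> : eta2 * (1 - eta) = alpha / xi.
      by rewrite /eta2; field; rewrite !gt_eqF//; lra.
    by field; rewrite gt_eqF.
  apply: ge0_ler_powR; rewrite ?nnegrE ?mulr_ge0 ?powR_ge0//; try lra.
  apply: (@le_trans _ _ (pull_scale * n%:R `^ eta2)); last first.
    by rewrite /v ler_peMr//; lra.
  by rewrite ler_pM2r ?le_max ?lexx ?orbT//; lra.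
apply: (@le_trans _ _ (P [set w | (u%:R < (Tarm a i n w)%:R :> R)%R])).
  apply: le_measure; rewrite ?inE; [exact: measurable_Tarm_gt..|].
  by move=> w /=; apply: le_lt_trans; rewrite -!mulrA in u2v *; rewrite /v -?mulrA in u2v.
apply: le_trans (pulls_tail_nat _ ij Dij n0 bD) _ => //.
(* Since [z <= v < u] and [1 - alpha] is negative, the power of [u] is at most that of [z]. *)
rewrite lee_fin ler_wpM2l ?pull_tail_const_ge0//.
rewrite -opprB !powRN lef_pV2 ?posrE ?powR_gt0; try lra.
by apply: ge0_ler_powR; rewrite ?nnegrE; lra.
Qed.

End ucb_tails.

(** * Tail of the stream estimate *)

Definition stream_slope (R : realType) (beta b : R) : R := expR (2 * (beta * b)) / beta.

Definition stream_scale (R : realType) (K : nat) (beta thetaL xi eta Dmin b : R) : R :=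
  1 + stream_slope beta b * (K%:R * (2 * pull_scale thetaL xi eta Dmin)).

(** Two tails of the optimal arm and up to [K] pull-count tails are added up; the power of the scale
    undoes the division of [z] by it. *)
Definition stream_tail_const (R : realType) (K : nat)
    (beta thetaL xi alpha eta Dmin b : R) : R :=
  (2 * thetaL + K%:R * pull_tail_const thetaL xi Dmin + 1) *
  stream_scale K beta thetaL xi eta Dmin b `^ (alpha - 1).

Lemma stream_slope_ge0 (R : realType) (beta b : R) : 0 < beta -> 0 <= stream_slope beta b.
Proof. by move=> b0; rewrite divr_ge0 ?expR_ge0 ?ltW. Qed.

Lemma stream_scale_ge1 (R : realType) K (beta thetaL xi eta Dmin b : R) :
  0 < beta -> 1 <= stream_scale K beta thetaL xi eta Dmin b.
Proof.
move=> b0; rewrite lerDl mulr_ge0 ?stream_slope_ge0// !mulr_ge0//.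
by rewrite (@le_trans _ _ 1)// le_max lexx.
Qed.

Lemma stream_tail_const_gt1 (R : realType) K (beta thetaL xi alpha eta Dmin b : R) :
  0 < beta -> 1 < thetaL -> 2 < alpha ->
  1 < stream_tail_const K beta thetaL xi alpha eta Dmin b.
Proof.
move=> b0 tL al; have h := stream_scale_ge1 K thetaL xi eta Dmin b b0.
have q1 : 1 <= stream_scale K beta thetaL xi eta Dmin b `^ (alpha - 1).
  by rewrite -[leLHS](powRr0 (stream_scale K beta thetaL xi eta Dmin b)) ler_powR//; lra.
have k0 : 0 <= K%:R * pull_tail_const thetaL xi Dmin by rewrite mulr_ge0 ?pull_tail_const_ge0.
apply: (@lt_le_trans _ _ (2 * thetaL + K%:R * pull_tail_const thetaL xi Dmin + 1)).
  lra.
by rewrite ler_peMr//; lra.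
Qed.

Section stream_tail.
Variables (R : realType) (K : nat) (S : finType).
Variables (d : measure_display) (T : measurableType d) (P : probability T R).
Variables (beta gamma thetaL xi alpha eta Dmin b : R) (c : 'I_K -> R).
Variables (X : 'I_K -> S -> nat -> T -> R) (Y : 'I_K -> nat -> T -> S).
Variables (a : nat -> T -> 'I_K) (mu : 'I_K -> R) (j : 'I_K).

Lemma stream_tail (A : set T) (n : nat) (z : R) :
  0 < beta -> 1 < thetaL -> 1 < xi -> 0 <= eta -> eta < 1 -> 2 < alpha ->
  xi * eta * (1 - eta) <= alpha -> alpha < xi * (1 - eta) -> 0 < Dmin ->
  (forall i s t w, `|c i + gamma * X i s t w| <= b) ->
  (forall i s t, measurable_fun setT (X i s t)) ->
  (forall i k s, measurable [set w | Y i k w = s]) ->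
  (forall t i, measurable [set w | a t w = i]) ->
  (forall i n z, (1 <= n)%N -> 1 <= z ->
    (P [set w | (n%:R * rho_arm beta gamma c X Y i n w - n%:R * mu i
                 >= n%:R `^ eta * z)%R] <= (thetaL / z `^ xi)%:E)%E /\
    (P [set w | (n%:R * rho_arm beta gamma c X Y i n w - n%:R * mu i
                 <= - (n%:R `^ eta * z))%R] <= (thetaL / z `^ xi)%:E)%E) ->
  ucb_run beta gamma thetaL xi alpha eta c X Y a ->
  (forall i, i != j -> Dmin <= mu i - mu j) ->
  (0 < n)%N -> 1 <= z -> measurable A ->
  (forall w, A w -> n%:R `^ (alpha / (xi * (1 - eta))) * z
     <= `|n%:R * rho_stream beta gamma c X Y a n w - n%:R * mu j|) ->
  (P A <= (stream_tail_const K beta thetaL xi alpha eta Dmin b / z `^ (alpha - 1))%:E)%E.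
Proof.
move=> beta0 tL1 xi1 eta0 eta1 al2 axl alx D0 cost_b mX mY ma tails run gap n0 z1 mA Adev.
set eta2 := alpha / (xi * (1 - eta)) in Adev *.
rewrite /stream_tail_const; set B := stream_scale _ _ _ _ _ _ _.
have B1 : 1 <= B by exact: stream_scale_ge1.
set C1 := pull_tail_const thetaL xi Dmin.
have C10 : 0 <= C1 by exact: pull_tail_const_ge0.
have KC : 0 <= K%:R * C1 by rewrite mulr_ge0.
have z0 : 0 < z by lra.
have B0 : 0 < B by lra.
have zB : B `^ (alpha - 1) / z `^ (alpha - 1) = (z / B) `^ (1 - alpha).
  rewrite -[1 - alpha]opprB [in RHS]powRN powRM ?invr_ge0 ?ltW// invfM.
  by rewrite -[B^-1]powR_inv1 ?ltW// -powRrM mulN1r powRN invrK mulrC.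
rewrite -mulrA zB; have zB0 : 0 <= (z / B) `^ (1 - alpha) := powR_ge0 _ _.
(* For [z < B] the claimed bound is at least 1, hence trivial; otherwise [z / B >= 1] is admissible
   in the tails. *)
case: (ltP z B) => [ltzB|leBz].
  apply: le_trans (probability_le1 P mA) _; rewrite lee_fin.
  have : 1 <= (z / B) `^ (1 - alpha).
    rewrite -[1 - alpha]opprB powRN invf_ge1 ?powR_gt0 ?divr_gt0//.
    have {2}<- : 1 `^ (alpha - 1) = 1 :> R by rewrite powR1.
    by apply: ge0_ler_powR; rewrite ?nnegrE ?ler_pdivrMr ?divr_ge0//; lra.
  nra.
set y := z / B in zB0 *; have y1 : 1 <= y by rewrite ler_pdivlMr ?mul1r.
have n1 : 1 <= n%:R :> R by rewrite ler1n.
(* The hypothesis [xi * eta * (1 - eta) <= alpha] says exactly [eta <= eta2]. *)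
have ee2 : n%:R `^ eta <= n%:R `^ eta2.
  by apply: ler_powR => //; rewrite ler_pdivlMr; [rewrite mulrCA; lra|apply: mulr_gt0; lra].
pose sc := pull_scale thetaL xi eta Dmin.
have sc1 : 1 <= sc by rewrite le_max lexx.
(* The left summand indexes the two tails of arm [j], the right one excessive pulls of each arm; [j]
   itself gets the empty event. *)
pose F (k : bool + 'I_K) : set T := match k with
  | inl true => [set w | (n%:R * rho_arm beta gamma c X Y j n w - n%:R * mu j
                 >= n%:R `^ eta * y)%R]
  | inl false => [set w | (n%:R * rho_arm beta gamma c X Y j n w - n%:R * mu j
                 <= - (n%:R `^ eta * y))%R]
  | inr i => if i == j then set0 else
      [set w | (2 * sc * n%:R `^ eta2 * y < (Tarm a i n w)%:R :> R)%R]
  end.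
pose e (k : bool + 'I_K) : R := match k with
  | inl _ => thetaL * y `^ (1 - alpha) | inr _ => C1 * y `^ (1 - alpha) end.
apply: (@le_trans _ _ (\sum_(k <- [:: inl true; inl false] ++
    [seq inr i | i <- enum 'I_K]) e k)%:E); last first.
  rewrite lee_fin big_cat big_map big_enum/= !big_cons big_nil sumr_const card_ord.
  by rewrite /e -[(_ * _) *+ _]mulr_natl addr0; nra.
have mdev i : measurable_fun setT
    (fun w => n%:R * rho_arm beta gamma c X Y i n w - n%:R * mu i).
  by apply: measurable_funB => //; apply: measurable_funM => //; exact: measurable_rho_arm.
apply: (@prob_union_le _ _ _ _ _ _ _ F) => //.
- case=> [[]|i] /=; [exact: measurable_set_ge|exact: measurable_set_le|].
  by case: eqP => // _; exact: measurable_Tarm_gt.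
- move=> w /Adev dev; apply: contrapT => none.
  have noF k : k \in [:: inl true; inl false] ++ [seq inr i | i <- enum 'I_K] -> ~ F k w.
    by move=> kr Fk; apply: none; exists k.
  have up := noF (inl true) isT; have dn := noF (inl false) isT.
  have {up dn} arm : `|n%:R * rho_arm beta gamma c X Y j n w - n%:R * mu j| <
      n%:R `^ eta * y.
    by rewrite ltr_norml !ltNge; apply/andP; split; apply/negP.
  have pulls : (n - Tarm a j n w)%:R <= K%:R * (2 * sc * n%:R `^ eta2 * y).
    rewrite -sum_Tarm_ne natr_sum.
    apply: (@le_trans _ _ (\sum_(i < K) (2 * sc * n%:R `^ eta2 * y))).
      rewrite big_mkcond ler_sum// => i _; case: ifPn => [ij|_].
        rewrite leNgt; apply/negP => h; apply: (noF (inr i)).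
          by rewrite mem_cat map_f ?mem_enum ?orbT.
        by rewrite /= (negbTE ij).
      by rewrite !mulr_ge0 ?powR_ge0 ?invr_ge0//; lra.
    by rewrite big_const_ord iter_addr addr0 -[leLHS]mulr_natl.
  have slope0 := stream_slope_ge0 b beta0.
  have := @dist_rho_stream_arm _ _ _ _ beta gamma c X Y b w (fun i s t => cost_b i s t w)
    beta0 a j n n0.
  rewrite -/(stream_slope beta b) => dist.
  have := lerD (ltW arm) (le_trans dist (ler_wpM2l slope0 pulls)).
  set p := n%:R * rho_stream _ _ _ _ _ _ _ _ in dev dist *.
  set q := n%:R * rho_arm _ _ _ _ _ _ _ _ in arm dist *.
  set m := n%:R * mu j in dev arm *.
  have tri : `|p - m| <= `|q - m| + `|p - q|.
    by rewrite (_ : p - m = (q - m) + (p - q)) ?ler_normD//; ring.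
  have zBy : z = B * y by rewrite /y; field; rewrite gt_eqF.
  have E : n%:R `^ eta2 * z = n%:R `^ eta2 * y +
      stream_slope beta b * (K%:R * (2 * sc * n%:R `^ eta2 * y)).
    by rewrite zBy /B /stream_scale -/sc; ring.
  have ley : n%:R `^ eta * y <= n%:R `^ eta2 * y by rewrite ler_wpM2r//; lra.
  have dlt := le_trans dist (ler_wpM2l slope0 pulls).
  by move=> _; lra.
(* The arm tails decay fast enough because [alpha - 1 < xi * (1 - eta) <= xi]. *)
- have tailE : thetaL / y `^ xi <= thetaL * y `^ (1 - alpha).
    have xe : 0 <= xi * eta by rewrite mulr_ge0//; lra.
    by rewrite -powRN ler_wpM2l ?ler_powR//; lra.
  move=> [[]|i] _ /=.
  + by apply: le_trans (tails j n y n0 y1).1 _; rewrite lee_fin.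
  + by apply: le_trans (tails j n y n0 y1).2 _; rewrite lee_fin.
  + case: eqP => [_|/eqP ij]; first by rewrite measure0 lee_fin mulr_ge0.
    exact: (pulls_tail tL1 xi1 eta1 al2 alx D0 mX mY ma tails run ij (gap i ij) n0 y1).
Qed.

End stream_tail.

(** * Concentration, bias and limit of the stream estimate *)

Theorem theorem5 (R : realType) (K : nat)
  (Rb beta theta xi eta alpha thetaL Dmin : R) :
  0 < beta -> 1 < theta -> 1 < xi -> 1 / 2 <= eta -> eta < 1 ->
  2 < alpha -> xi * eta * (1 - eta) <= alpha -> alpha < xi * (1 - eta) ->
  1 < thetaL ->
  exists theta2 : R, 1 < theta2 /\ exists C : R, 0 < C /\
  forall (d : measure_display) (T : measurableType d) (P : probability T R)
    (S : finType) (gamma Rc Rx : R) (c : 'I_K -> R) (Pi : 'I_K -> S -> R)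
    (X : 'I_K -> S -> nat -> T -> R) (Y : 'I_K -> nat -> T -> S)
    (muS : 'I_K -> S -> R) (a : nat -> T -> 'I_K) (istar : 'I_K),
  (* discount factor and bounds *)
  0 < gamma -> gamma <= 1 -> Rb = Rc + Rx ->
  (forall i, - Rc <= c i <= Rc) ->
  (forall i s t w, - Rx <= X i s t w <= Rx) ->
  (* measurability *)
  (forall i s t, measurable_fun setT (X i s t)) ->
  (forall i k s, measurable [set w | Y i k w = s]) ->
  (forall t i, measurable [set w | a t w = i]) ->
  (* next-state distributions *)
  (forall i s, 0 <= Pi i s) -> (forall i, \sum_(s : S) Pi i s = 1) ->
  next_states_iid P Y Pi ->
  (* the assumption on the per-state estimates *)
  (forall i s, (fun n => 'E_P[rho_state beta gamma X i s n])%E @ \oo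
               --> (muS i s)%:E) ->
  (forall i s n z, (1 <= n)%N -> 1 <= z ->
     (P [set w | (n%:R * rho_state beta gamma X i s n w - n%:R * muS i s
                  >= n%:R `^ eta * z)%R] <= (theta / z `^ xi)%:E)%E /\
     (P [set w | (n%:R * rho_state beta gamma X i s n w - n%:R * muS i s
                  <= - (n%:R `^ eta * z))%R] <= (theta / z `^ xi)%:E)%E) ->
  (* the constant theta^L for the arm-level estimates *)
  (forall i n z, (1 <= n)%N -> 1 <= z ->
     (P [set w | (n%:R * rho_arm beta gamma c X Y i n w
                - n%:R * mu_arm beta gamma c Pi muS i
                  >= n%:R `^ eta * z)%R] <= (thetaL / z `^ xi)%:E)%E /\
     (P [set w | (n%:R * rho_arm beta gamma c X Y i n w
                - n%:R * mu_arm beta gamma c Pi muS i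
                  <= - (n%:R `^ eta * z))%R] <= (thetaL / z `^ xi)%:E)%E) ->
  (* unique optimal arm and Delta_min *)
  (forall i, i != istar ->
     mu_arm beta gamma c Pi muS istar < mu_arm beta gamma c Pi muS i) ->
  (forall i, i != istar ->
     Dmin <= mu_arm beta gamma c Pi muS i - mu_arm beta gamma c Pi muS istar) ->
  (exists2 i, i != istar &
     Dmin = mu_arm beta gamma c Pi muS i - mu_arm beta gamma c Pi muS istar) ->
  (* the algorithm *)
  ucb_run beta gamma thetaL xi alpha eta c X Y a ->
  let mustar := mu_arm beta gamma c Pi muS istar in
  let eta2 := alpha / (xi * (1 - eta)) in
  let xi2 := alpha - 1 in
  ((forall n z, (1 <= n)%N -> 1 <= z ->
     (P [set w | (n%:R * rho_stream beta gamma c X Y a n w - n%:R * mustar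
                  >= n%:R `^ eta2 * z)%R] <= (theta2 / z `^ xi2)%:E)%E /\
     (P [set w | (n%:R * rho_stream beta gamma c X Y a n w - n%:R * mustar
                  <= - (n%:R `^ eta2 * z))%R] <= (theta2 / z `^ xi2)%:E)%E) /\
   (forall n, (1 <= n)%N ->
     (`| mustar%:E - 'E_P[rho_stream beta gamma c X Y a n] |
        <= (C * theta2 * n%:R `^ (eta2 - 1))%:E)%E) /\
   ((fun n => 'E_P[rho_stream beta gamma c X Y a n])%E @ \oo --> mustar%:E)).
Proof.
move=> beta0 theta1 xi1 eta_half eta1 al2 axl alx tL1.
pose theta2 := stream_tail_const K beta thetaL xi alpha eta Dmin Rb.
have theta2_gt1 : 1 < theta2 by exact: stream_tail_const_gt1.
exists theta2; split=> //.
have zeta0 : 0 <= 1 / (alpha - 1 - 1) by rewrite divr_ge0//; lra.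
(* This is the factor of [dist_mean_le_tails] at [q = alpha - 1], with its leading 1 absorbed into
   [theta2 > 1]. *)
exists (1 + 2 * (1 + 1 / (alpha - 1 - 1))); split; first by lra.
move=> d T P S gamma Rc Rx c Pi X Y muS a istar gamma0 gamma1 RbE c_b X_b mX mY ma.
move=> _ _ _ _ _ arm_tails lt_mu gap [k kistar DminE] run mustar eta2 xi2.
have D0 : 0 < Dmin by rewrite DminE subr_gt0 lt_mu.
have eta0 : 0 <= eta by lra.
have cost_b i s t w : `|c i + gamma * X i s t w| <= Rb.
  have /andP[c1 c2] := c_b i; have /andP[x1 x2] := X_b i s t w.
  by rewrite ler_norml RbE; apply/andP; split; nra.
have tail A n z := @stream_tail R K S d T P beta gamma thetaL xi alpha eta Dmin Rb c X Y a
  (mu_arm beta gamma c Pi muS) istar A n z beta0 tL1 xi1 eta0 eta1 al2 axl alx D0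
  cost_b mX mY ma arm_tails run gap.
rewrite -/mustar -/eta2 -/xi2 -/theta2 in tail.
have mstream n : measurable_fun setT (rho_stream beta gamma c X Y a n).
  exact: measurable_rho_stream.
have mdev n : measurable_fun setT
    (fun w => n%:R * rho_stream beta gamma c X Y a n w - n%:R * mustar).
  by apply: measurable_funB => //; apply: measurable_funM.
have concentration n z : (1 <= n)%N -> 1 <= z ->
    (P [set w | (n%:R * rho_stream beta gamma c X Y a n w - n%:R * mustar
                  >= n%:R `^ eta2 * z)%R] <= (theta2 / z `^ xi2)%:E)%E /\
    (P [set w | (n%:R * rho_stream beta gamma c X Y a n w - n%:R * mustar
                  <= - (n%:R `^ eta2 * z))%R] <= (theta2 / z `^ xi2)%:E)%E.
  move=> n0 z1; split; apply: (tail _ n) => //.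
  - exact: measurable_set_ge.
  - by move=> w /= h; apply: le_trans h (ler_norm _).
  - exact: measurable_set_le.
  - by move=> w /=; rewrite lerNr -normrN => h; apply: le_trans h (ler_norm _).
have mean n : (1 <= n)%N -> (`| mustar%:E - 'E_P[rho_stream beta gamma c X Y a n] |
    <= ((1 + 2 * (1 + 1 / (alpha - 1 - 1))) * theta2 * n%:R `^ (eta2 - 1))%:E)%E.
  move=> n0; have n0' : 0 < n%:R :> R by rewrite ltr0n.
  have u0 : 0 < n%:R `^ (eta2 - 1) :> R by exact: powR_gt0.
  have nu : n%:R `^ eta2 = n%:R * n%:R `^ (eta2 - 1) :> R.
    rewrite -[X in X * _ `^ _](powRr1 (ltW n0')) -powRD ?(gt_eqF n0') ?implybT//.
    by congr (_ `^ _); lra.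
  apply: le_trans (@dist_mean_le_tails _ _ _ P _ mustar Rb _ xi2 theta2 (mstream n) _ u0 _ _ _) _.
  - by move=> w; apply: rho_stream_bounded => // i s t; exact: cost_b.
  - by rewrite /xi2; lra.
  - by lra.
  - move=> z z1; have [] := concentration n z n0 z1.
    rewrite nu; set A1 := [set _ | _]; set A2 := [set _ | _].
    rewrite (_ : A1 = [set w | (rho_stream beta gamma c X Y a n w - mustar
      >= n%:R `^ (eta2 - 1) * z)%R]); last first.
      by apply/funext => w; apply/propext; rewrite /A1/= -mulrBr -(mulrA n%:R) ler_pM2l.
    rewrite (_ : A2 = [set w | (rho_stream beta gamma c X Y a n w - mustar
      <= - (n%:R `^ (eta2 - 1) * z))%R])//.
    by apply/funext => w; apply/propext; rewrite /A2/= -mulrBr -(mulrA n%:R) -(mulrN n%:R) ler_pM2l.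
  - rewrite lee_fin mulrC ler_pM2r// /xi2; nra.
split; [exact: concentration|split; [exact: mean|]].
have eta2_lt1 : eta2 < 1.
  by rewrite /eta2 ltr_pdivrMr ?mul1r// mulr_gt0//; lra.
set C := (1 + _) * theta2 in mean.
pose bnd n : R := C * n%:R `^ (- (1 - eta2)).
have bnd0 : bnd @ \oo --> (0 : R).
  rewrite -[X in _ --> X](mulr0 C); apply: cvgMr.
  by apply: cvg_powRN; rewrite subr_gt0.
apply: (@squeeze_cvge _ _ _ _ (fun n => (mustar - bnd n)%:E) _ (fun n => (mustar + bnd n)%:E)).
- near=> n; have n0 : (1 <= n)%N by near: n; exact: nbhs_infty_ge.
  have := mean n n0; rewrite -opprB -/(bnd n).
  (* The finite bound on the distance excludes an infinite mean. *)
  case: ('E_P[_])%E => [r| |] //=; rewrite -?EFinB !lee_fin.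
  by rewrite ler_norml => /andP[h1 h2]; apply/andP; split; lra.
- apply: cvg_EFin; first by near=> n.
  by rewrite -[X in _ --> X]subr0; apply: cvgB => //; exact: cvg_cst.
- apply: cvg_EFin; first by near=> n.
  by rewrite -[X in _ --> X]addr0; apply: cvgD => //; exact: cvg_cst.
Unshelve. all: by end_near.
Qed.
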